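(* Let $A \in \mathbb{R}^{n\times n}$ and let $(\alpha_k)_{k \in \mathbb{N}}$ be a real sequence such that $0 < \alpha_k \le \alpha^{\max} < \infty$ for all $k \in \mathbb{N}$, for some $\alpha^{\max}$, with $\lim_{k\to\infty} \alpha_k = 0$ and $\sum_{k=0}^{\infty} \alpha_k = \infty$. The following statements are equivalent: (i) the linear mapping $\mathcal{A}: \mathbb{R}^n \to \mathbb{R}^n$, $x \mapsto Ax$, is strictly pseudocontractive; (ii) for every initial condition $x(0) \in \mathbb{R}^n$, the solution to $$x(k+1) = (1-\alpha_k)\, x(k) + \alpha_k A\, x(k), \quad k \in \mathbb{N},$$ converges to some $\overline{x} \in \ker(I-A)$, i.e., to some fixed point of $\mathcal{A}$ (the limit $\overline{x}$ may depend on $x(0)$).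
   Context: Norms $\|\cdot\|$ on $\mathbb{R}^n$ are Hilbert-space norms, i.e., induced by an inner product (equivalently, of the form $\|x\|_P = \sqrt{x^\top P x}$ with $P$ symmetric positive definite). For $\kappa \in (0,1)$, a Lipschitz continuous mapping $\mathcal{T}:\mathbb{R}^n\to\mathbb{R}^n$ is $\kappa$-strictly pseudocontractive with respect to $\|\cdot\|$ if for all $x,y \in \mathbb{R}^n$ $$\|\mathcal{T}(x)-\mathcal{T}(y)\|^2 \le \|x-y\|^2 + \kappa \,\|(\mathrm{Id}-\mathcal{T})(x) - (\mathrm{Id}-\mathcal{T})(y)\|^2 .$$ $\mathcal{T}$ is strictly pseudocontractive if there exist $\kappa \in (0,1)$ and a (Hilbert) norm $\|\cdot\|$ on $\mathbb{R}^n$ such that $\mathcal{T}$ is $\kappa$-strictly pseudocontractive with respect to $\|\cdot\|$. Here $\mathrm{Id}$ is the identity operator and $\ker(I-A)=\{x \in \mathbb{R}^n : x = Ax\}$. *)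

(* Defs.v *)
From HB Require Import structures.
From mathcomp Require Import all_boot all_order all_algebra.
From mathcomp Require Import all_classical all_reals all_analysis.

Set Implicit Arguments.
Unset Strict Implicit.
Unset Printing Implicit Defensive.

Import Order.TTheory GRing.Theory Num.Theory.
Import numFieldNormedType.Exports.

Local Open Scope classical_set_scope.
Local Open Scope ring_scope.

(* With theta := idfun, {dot V for idfun} is the type of inner products on V:
   symmetric bilinear positive definite forms. *)
Definition hilbert_norm (R : realType) (V : lmodType R)
    (form : {dot V for idfun}) (x : V) : R :=
  Num.sqrt (form x x).

(* The Lipschitz requirement is stated in the ambient max norm of 'cV[R]_n; by
   equivalence of norms in finite dimension, its choice is immaterial. *)
Definition strictly_pseudocontractive_for (R : realType) (n : nat) (kappa : R)
    (form : {dot 'cV[R]_n for idfun}) (T : 'cV[R]_n -> 'cV[R]_n) : Prop :=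
  lipschitz T /\
  forall x y : 'cV[R]_n,
    hilbert_norm form (T x - T y) ^+ 2 <=
      hilbert_norm form (x - y) ^+ 2 +
      kappa * hilbert_norm form ((x - T x) - (y - T y)) ^+ 2.

Definition strictly_pseudocontractive (R : realType) (n : nat)
    (T : 'cV[R]_n -> 'cV[R]_n) : Prop :=
  exists (kappa : R) (form : {dot 'cV[R]_n for idfun}),
    0 < kappa < 1 /\ strictly_pseudocontractive_for kappa form T.

Fixpoint mann_iteration (R : realType) (n : nat) (alpha : R^nat)
    (T : 'cV[R]_n -> 'cV[R]_n) (x0 : 'cV[R]_n) (k : nat) : 'cV[R]_n :=
  if k is j.+1 then
    let x := mann_iteration alpha T x0 j in
    (1 - alpha j) *: x + alpha j *: T x
  else x0.

(* Main.v *)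
(* Put B = I - A, so that x(k+1) = x(k) - alpha_k B x(k). Since A = I - B, strict
   pseudocontractivity for the inner product q says that B is cocoercive:
   h q(Bz, Bz) <= 2 q(z, Bz) with h = 1 - kappa.

   If B is cocoercive, then q(x(k), x(k)) is eventually nonincreasing and
   B x(k) tends to 0. Moreover ker B^2 = ker B, hence x(0) = p + B u with B p = 0,
   and x(k) = p + B u(k), where u(k) is the iteration started at u, tends to p.

   Conversely, if all the iterations converge, then ker B^2 = ker B, because on
   ker B^2 the iterates are x(0) - (alpha_0 + ... + alpha_(k-1)) B x(0). Let pi be
   the projection onto ker B along the range of B. The complex eigenvalues of B + pi
   have positive real part, so, after a Schur triangularization over R[i], a
   diagonally weighted Hermitian form makes B + pi coercive, hence cocoercive. *)

Require Import Defs.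
From HB Require Import structures.
From mathcomp Require Import all_boot all_order all_algebra.
From mathcomp Require Import all_classical all_reals all_analysis.
From mathcomp Require Import zify ring lra.
From mathcomp Require Import complex.
Import Order.TTheory GRing.Theory Num.Theory.
Import numFieldNormedType.Exports.
Local Open Scope classical_set_scope.
Local Open Scope ring_scope.

Set Implicit Arguments.
Unset Strict Implicit.

(** * Matrices with [ker B^2 = ker B], and the projection onto the kernel *)

Lemma sqr_kernel_factor (F : fieldType) (n : nat) (B : 'M[F]_n) :
  (forall z : 'cV[F]_n, B *m (B *m z) = 0 -> B *m z = 0) ->
  exists X : 'M[F]_n, B = B *m B *m X.
Proof.
move=> kerB.
(* [kermx] is a left kernel, hence the transposes. Comparing kernels gives equal ranks, so [B^T] and
   [B^T B^T] have the same row space. *)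
have kerBT : (kermx (B^T *m B^T) <= kermx B^T)%MS.
  apply/rV_subP => v /sub_kermxP vBB; apply/sub_kermxP.
  apply: trmx_inj; rewrite trmx_mul trmxK trmx0; apply: kerB.
  by apply: trmx_inj; rewrite !trmx_mul trmxK trmx0 -mulmxA.
have rkB : (\rank B^T <= \rank (B^T *m B^T))%N.
  have := mxrankS kerBT; rewrite !mxrank_ker.
  have := rank_leq_row B^T; have := rank_leq_row (B^T *m B^T); lia.
have : (B^T <= B^T *m B^T)%MS.
  by rewrite -(geq_leqif (mxrank_leqif_sup (submxMl B^T B^T))).
case/submxP => Y BY; exists Y^T.
by apply: trmx_inj; rewrite BY !trmx_mul !trmxK.
Qed.

Section KernelProjection.
Context {F : fieldType} {n : nat} {B X : 'M[F]_n}.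
Hypothesis BX : B = B *m B *m X.
Hypothesis kerB : forall z : 'cV[F]_n, B *m (B *m z) = 0 -> B *m z = 0.

(** With the next two lemmas: [1 - B X] is the projection onto [ker B] along the range of [B]. *)
Lemma mul_kernel_proj : B *m (1%:M - B *m X) = 0.
Proof. by rewrite mulmxBr mulmx1 mulmxA -BX subrr. Qed.

(** Since [(1 - B X) B = B (1 - X B)], each column of the product is some [B w]; it is killed by
    [B], because [B (1 - B X) = 0], so [kerB] makes it vanish. *)
Lemma kernel_proj_mul : (1%:M - B *m X) *m B = 0.
Proof.
have E : (1%:M - B *m X) *m B = B *m (1%:M - X *m B).
  by rewrite mulmxBl mulmxBr mul1mx mulmx1 mulmxA.
apply/matrixP => i j; rewrite [RHS]mxE.
suff /colP/(_ i) : col j ((1%:M - B *m X) *m B) = 0 by rewrite !mxE.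
rewrite colE E -mulmxA; apply: kerB.
by rewrite !mulmxA -(mulmxA B) -E mulmxA mul_kernel_proj !mul0mx.
Qed.

Lemma kernel_proj_id (z : 'cV[F]_n) : B *m z = 0 -> (1%:M - B *m X) *m z = z.
Proof.
move=> Bz; rewrite mulmxBl mul1mx -mulmxA kerB ?subr0 //.
by rewrite !mulmxA -BX.
Qed.

End KernelProjection.

(** * Algebra of the iteration *)

Section Mann.
Context {R : realType} {n : nat} (A : 'M[R]_n) (alpha : R^nat).
Local Notation B := (1%:M - A).
Local Notation mann := (mann_iteration alpha (mulmx A)).

Lemma mannS (x : 'cV[R]_n) k : mann x k.+1 = mann x k - alpha k *: (B *m mann x k).
Proof.
by rewrite /= mulmxBl mul1mx scalerBl scale1r scalerBr opprB addrA addrAC.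
Qed.

(** Serves with [C] equal to [B], and later to the projection onto [ker B]. *)
Lemma mann_mul (C : 'M[R]_n) (x : 'cV[R]_n) k :
  C *m B = B *m C -> C *m mann x k = mann (C *m x) k.
Proof.
move=> CB; elim: k => [//|k IH].
by rewrite !mannS mulmxBr -scalemxAr mulmxA CB -mulmxA IH.
Qed.

Lemma mannD (x y : 'cV[R]_n) k : mann (x + y) k = mann x k + mann y k.
Proof.
elim: k => [//|k IH]; rewrite !mannS IH mulmxDr scalerDr opprD.
by rewrite addrACA.
Qed.

Lemma mann_fix (x : 'cV[R]_n) k : B *m x = 0 -> mann x k = x.
Proof.
by move=> Bx; elim: k => [//|k IH]; rewrite mannS IH Bx scaler0 subr0.
Qed.

Lemma mann_nilpotent (z : 'cV[R]_n) k : B *m (B *m z) = 0 ->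
  mann z k = z - series alpha k *: (B *m z).
Proof.
move=> BBz; elim: k => [|k IH].
  by rewrite /series /= big_geq // scale0r subr0.
rewrite mannS IH mulmxBr -scalemxAr BBz scaler0 subr0.
by rewrite seriesSr scalerDl opprD addrA.
Qed.

End Mann.

(** * Inner products on column vectors *)

Record inner_product {R : realType} {n : nat} (q : 'cV[R]_n -> 'cV[R]_n -> R) : Prop :=
  InnerProduct {
    ipC : forall x y, q x y = q y x;
    ipP : forall a x y z, q (a *: x + y) z = a * q x z + q y z;
    ip_gt0 : forall x, x != 0 -> 0 < q x x }.


Lemma dot_inner_product (R : realType) (n : nat) (form : {dot 'cV[R]_n for idfun}) :
  inner_product form.
Proof.
split=> [x y|a x y z|x].
- by rewrite hermC /= expr0 mul1r.
- by rewrite linearPl.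
- exact: neq0_dnorm_gt0.
Qed.

Section DotOfInnerProduct.
Context {R : realType} {n : nat} (q : 'cV[R]_n -> 'cV[R]_n -> R).
Hypothesis ipq : inner_product q.

Let bilinearq : bilinear_for *%R (idfun \; *%R) q.
Proof.
split=> [u a x y|u a x y]; first exact: (ipP ipq).
by rewrite !(ipC ipq u) (ipP ipq).
Qed.

Let hermitianq x y : q x y = (-1) ^+ false * idfun (q y x).
Proof. by rewrite /= expr0 mul1r (ipC ipq). Qed.

(** Lets forms be built below as bare functions with laws, and packed only at the end into the
    structure that [strictly_pseudocontractive] asks for. *)
Lemma inner_product_dot : exists form : {dot 'cV[R]_n for idfun}, forall x y, form x y = q x y.
Proof.
pose qB := bilinear_isBilinear.Build R _ _ _ _ _ q bilinearq.
pose qH := isHermitianSesquilinear.Build R _ false idfun q hermitianq.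
pose qD := isDotProduct.Build R _ q (ip_gt0 ipq).
pose form : {dot 'cV[R]_n for idfun} := HB.pack q qB qH qD.
by exists form.
Qed.

End DotOfInnerProduct.

Section InnerProductTheory.
Context {R : realType} {n : nat} {q : 'cV[R]_n -> 'cV[R]_n -> R}.
Hypothesis ipq : inner_product q.
Implicit Types (x y z : 'cV[R]_n) (a : R).

Lemma ip0l x : q 0 x = 0.
Proof. by have := ipP ipq 1 0 0 x; rewrite scale1r addr0 mul1r; lra. Qed.

Lemma ipDl x y z : q (x + y) z = q x z + q y z.
Proof. by have := ipP ipq 1 x y z; rewrite scale1r mul1r. Qed.

Lemma ipZl a x y : q (a *: x) y = a * q x y.
Proof. by have := ipP ipq a x 0 y; rewrite addr0 ip0l addr0. Qed.

Lemma ip_ge0 x : 0 <= q x x.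
Proof.
have [->|/(ip_gt0 ipq)/ltW//] := eqVneq x 0; by rewrite ip0l.
Qed.

Lemma ip_suml (I : finType) (F : I -> 'cV[R]_n) y : q (\sum_i F i) y = \sum_i q (F i) y.
Proof.
apply: (big_ind2 (fun u v => q u y = v)) => [|u _ v _ <- <-|//]; first exact: ip0l.
exact: ipDl.
Qed.

Lemma ip_sumZl x y : q x y = \sum_j x j 0 * q (delta_mx j 0) y.
Proof.
rewrite {1}(matrix_sum_delta x) ip_suml; apply: eq_bigr => j _.
by rewrite big_ord1 ipZl.
Qed.

Lemma ip_sub_scale x y a :
  q (x - a *: y) (x - a *: y) = q x x - 2 * a * q x y + a ^+ 2 * q y y.
Proof.
rewrite -scaleNr ipDl !(ipC ipq _ (x + _)) !ipDl !ipZl !(ipC ipq _ (_ *: _)) !ipZl.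
rewrite (ipC ipq y x); ring.
Qed.

Lemma ip_CauchySchwarz x y : q x y ^+ 2 <= q x x * q y y.
Proof.
have [->|y0] := eqVneq y 0; first by rewrite (ipC ipq x 0) !ip0l mulr0 expr0n.
have yy := ip_gt0 ipq y0.
have := ip_ge0 (x - (q x y / q y y) *: y).
rewrite ip_sub_scale => h.
rewrite -ler_pdivrMr // -subr_ge0; apply: le_trans h _.
by rewrite le_eqVlt; apply/orP; left; apply/eqP; field; rewrite gt_eqF.
Qed.

(** The [i]-th coordinate is [q x y] for a vector [y] read off the inverse Gram matrix [G];
    Cauchy-Schwarz then gives [c = q y y]. This turns smallness for [q] into smallness of
    coordinates. *)
Lemma ip_coord_bound (i : 'I_n) :
  exists c : R, forall x : 'cV[R]_n, x i 0 ^+ 2 <= c * q x x.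
Proof.
pose G := \matrix_(j, k) q (delta_mx j 0) (delta_mx k 0).
have qG x k : q x (delta_mx k 0) = (x^T *m G) 0 k.
  by rewrite ip_sumZl mxE; apply: eq_bigr => j _; rewrite !mxE.
have Gunit : G \in unitmx.
  rewrite -row_free_unit -kermx_eq0; apply/rowV0P => v /sub_kermxP vG.
  apply/eqP; apply: contraT => v0.
  have : 0 < q v^T v^T by rewrite (ip_gt0 ipq) // trmx_eq0.
  rewrite ip_sumZl big1 ?ltxx // => j _.
  by rewrite (ipC ipq) qG trmxK vG [X in _ * X]mxE mulr0.
pose y := (delta_mx 0 i *m invmx G)^T : 'cV[R]_n.
exists (q y y) => x.
suff <- : q x y = x i 0 by rewrite mulrC; exact: ip_CauchySchwarz.
rewrite ip_sumZl (bigD1 i) //= big1 ?addr0 => [|j ji].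
  by rewrite (ipC ipq) qG trmxK mulmxKV // mxE !eqxx mulr1.
by rewrite (ipC ipq) qG trmxK mulmxKV // mxE eqxx (negPf ji) /= mulr0.
Qed.

End InnerProductTheory.

(** * Convergence and Lipschitz continuity for column vectors *)

Section ColumnVectors.
Context {R : realType} {n : nat}.

Lemma cvg_colP (x : ('cV[R]_n)^nat) (l : 'cV[R]_n) :
  (forall i, x k i 0 @[k --> \oo] --> l i 0) -> x k @[k --> \oo] --> l.
Proof.
move=> xl; apply/cvgrPdist_lt => e e0.
have : \forall k \near \oo, forall i, `|l i 0 - x k i 0| < e.
  by apply: filter_forall => i; have /cvgrPdist_lt := xl i; apply.
apply: filterS => k xk; rewrite [X in X < _]mx_normrE.
by apply/bigmax_ltP; split=> // -[i j] _ /=; rewrite ord1 !mxE.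
Qed.

Lemma cvg_mulmx (M : 'M[R]_n) (x : ('cV[R]_n)^nat) (l : 'cV[R]_n) :
  x k @[k --> \oo] --> l -> (M *m x k) @[k --> \oo] --> M *m l.
Proof.
move=> xl; apply: cvg_colP => i; rewrite mxE.
under eq_fun do rewrite mxE.
apply: (@cvg_big R 'I_n +%R 0 xpredT add_continuous) => j _; apply: cvgMl_tmp.
exact: (continuous_cvg _ (@coord_continuous R n 1 j 0 l) xl).
Qed.

Lemma lipschitz_mulmx (A : 'M[R]_n) : lipschitz (fun x : 'cV[R]_n => A *m x).
Proof.
have proper := @globally_properfilter ('cV[R]_n * 'cV[R]_n)%type setT (0, 0) I.
rewrite setXTT; apply: (@klipschitzW _ _ _ (\sum_i \sum_j `|A i j|)) => -[x y] _ /=.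
rewrite -mulmxBr; set z := x - y.
rewrite [leLHS]mx_normrE; apply/bigmax_leP; split=> [|[i j] _ /=].
  by rewrite mulr_ge0 // sumr_ge0 // => i _; rewrite sumr_ge0.
rewrite mxE (le_trans (ler_norm_sum _ _ _)) //.
apply: (@le_trans _ _ (\sum_k `|A i k| * `|z|)).
  apply: ler_sum => k _; rewrite normrM ler_wpM2l //.
  by rewrite [leRHS]mx_normrE; apply/bigmax_geP; right; exists (k, j).
rewrite -mulr_suml ler_wpM2r // [leRHS](bigD1 i) //= lerDl sumr_ge0 // => k _.
exact: sumr_ge0.
Qed.

End ColumnVectors.

(** * Strict pseudocontractivity of a linear map as cocoercivity *)

Definition cocoercive {R : realType} {n : nat} (h : R) (q : 'cV[R]_n -> 'cV[R]_n -> R)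
    (B : 'M[R]_n) : Prop :=
  forall z, h * q (B *m z) (B *m z) <= 2 * q z (B *m z).

(** By linearity only [z = x - y] matters; expanding the squared norm of [A z = z - B z] gives the
    equivalence. *)
Lemma strictly_pseudocontractive_mulmxP (R : realType) (n : nat) (A : 'M[R]_n) :
  strictly_pseudocontractive (mulmx A) <->
  exists h q, [/\ 0 < h < 1, @inner_product R n q & cocoercive h q (1%:M - A)].
Proof.
have norm_mul (form : {dot 'cV[R]_n for idfun}) (x : 'cV[R]_n) :
    form (A *m x) (A *m x) = form x x - 2 * form x ((1%:M - A) *m x) +
      form ((1%:M - A) *m x) ((1%:M - A) *m x).
  have := ip_sub_scale (dot_inner_product form) x ((1%:M - A) *m x) 1.
  rewrite scale1r mulr1 expr1n mul1r => <-.
  by rewrite mulmxBl mul1mx subKr.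
have norm_sqr (form : {dot 'cV[R]_n for idfun}) x : hilbert_norm form x ^+ 2 = form x x.
  by rewrite sqr_sqrtr // ip_ge0 //; exact: dot_inner_product.
split=> [[kappa [form [/andP[k0 k1] [_ spc]]]]|[h [q [/andP[h0 h1] ipq coc]]]].
  exists (1 - kappa), form; split; [by apply/andP; split; lra|exact: dot_inner_product|move=> z].
  have := spc z 0; rewrite !norm_sqr mulmx0 !subr0 norm_mul.
  by rewrite mulmxBl mul1mx; lra.
have [form formE] := inner_product_dot ipq.
exists (1 - h), form; split; [by apply/andP; split; lra|split; first exact: lipschitz_mulmx].
move=> x y; rewrite !norm_sqr -mulmxBr norm_mul !formE.
have -> : x - A *m x - (y - A *m y) = (1%:M - A) *m (x - y).
  by rewrite mulmxBl mul1mx mulmxBr !opprB [LHS]addrACA [RHS]addrACA (addrC (- y)).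
have := coc (x - y); lra.
Qed.

(** * From cocoercivity to convergence *)

Section Sufficiency.
Context {R : realType} {n : nat} (A : 'M[R]_n) (alpha : R^nat).
Context (h : R) (q : 'cV[R]_n -> 'cV[R]_n -> R).
Hypothesis alpha_gt0 : forall k, 0 < alpha k.
Hypothesis alpha_cvg0 : alpha k @[k --> \oo] --> (0 : R).
Hypothesis alpha_sum : series alpha k @[k --> \oo] --> +oo.
Hypothesis h0 : 0 < h.
Hypothesis ipq : inner_product q.
Local Notation B := (1%:M - A).
Hypothesis coc : cocoercive h q B.
Local Notation mann := (mann_iteration alpha (mulmx A)).

(** For [w = B z] nonzero with [B w = 0], subtracting a multiple of [w] from [z] leaves [B z]
    unchanged; the multiple is chosen to make the right side of cocoercivity [-2], while the left
    side is positive. *)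
Lemma cocoercive_sqr_kernel (z : 'cV[R]_n) : B *m (B *m z) = 0 -> B *m z = 0.
Proof.
move=> BBz; set w := B *m z; apply/eqP; apply: contraT => w0.
have ww := ip_gt0 ipq w0.
have := coc (z - ((q z w + 1) / q w w) *: w).
rewrite mulmxBr -scalemxAr BBz scaler0 subr0 -/w -scaleNr addrC (ipP ipq).
rewrite mulNr divfK ?gt_eqF //.
have : 0 < h * q w w by exact: mulr_gt0.
by move: (h * _) (q z w) => a b; lra.
Qed.

(** By cocoercivity the cross term is at most [- h * alpha k * q w w], with [w] the residual; half
    of it absorbs the quadratic term as [alpha k <= h / 2]. *)
Lemma mann_norm_step (x : 'cV[R]_n) k : alpha k <= h / 2 ->
  q (mann x k.+1) (mann x k.+1) <=
  q (mann x k) (mann x k) - h / 2 * alpha k * q (B *m mann x k) (B *m mann x k).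
Proof.
move=> ak; rewrite mannS (ip_sub_scale ipq); set z := mann x k; set w := B *m z.
have := coc z; rewrite -/w => hz.
have ww := ip_ge0 ipq w; have a0 := alpha_gt0 k.
have : alpha k * (h * q w w) <= alpha k * (2 * q z w) by rewrite ler_wpM2l // ltW.
have : alpha k * alpha k * q w w <= alpha k * (h / 2) * q w w.
  by rewrite ler_wpM2r // ler_wpM2l // ltW.
lra.
Qed.

(* The squared residuals [b k] are eventually nonincreasing and [\sum_k alpha k * b k]
   is finite, hence [b m] is [O(1 / series alpha m)]. *)
Lemma mann_residual_cvg0 (x : 'cV[R]_n) :
  q (B *m mann x k) (B *m mann x k) @[k --> \oo] --> (0 : R).
Proof.
have h20 : 0 < h / 2 by rewrite divr_gt0.
have [K _ alpha_le] : \forall k \near \oo, alpha k <= h / 2.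
  have /cvgrPdist_lt/(_ _ h20) := alpha_cvg0; apply: filterS => k.
  by rewrite sub0r normrN => /ltW/(le_trans (ler_norm _)).
pose b k := q (B *m mann x k) (B *m mann x k).
pose e k := q (mann x k) (mann x k).
have b0 k : 0 <= b k by exact: ip_ge0.
have e0 k : 0 <= e k by exact: ip_ge0.
(* The residuals are themselves iterates, started at [B x], so [mann_norm_step] applies to them. *)
have bS k : (K <= k)%N -> b k.+1 <= b k.
  move=> /alpha_le ak; have BB : B *m B = B *m B by [].
  rewrite /b !(mann_mul _ _ _ BB); apply: le_trans (mann_norm_step _ ak) _.
  by rewrite gerBl !mulr_ge0 ?ip_ge0 // ltW.
(* Telescoped decrease of [e], in which monotonicity replaces every earlier [b] by the last one. *)
have key m : e (m + K)%N + h / 2 * b (m + K)%N * (series alpha (m + K)%N - series alpha K) <= e K.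
  elim: m => [|m IH]; first by rewrite add0n subrr mulr0 addr0.
  apply: le_trans IH; rewrite addSn seriesSr.
  have Km : (K <= m + K)%N by exact: leq_addl.
  have := mann_norm_step x (alpha_le _ Km); rewrite -/(e _) -/(e _) -/(b _) => eS.
  have SK : 0 <= series alpha (m + K)%N - series alpha K.
    by rewrite subr_ge0 nondecreasing_series // => i _ _; exact: ltW.
  set s := _ - series alpha K in SK *.
  have -> : series alpha (m + K)%N + alpha (m + K)%N - series alpha K = s + alpha (m + K)%N.
    by rewrite /s addrAC.
  have : h / 2 * b (m + K).+1 * (s + alpha (m + K)%N) <=
         h / 2 * b (m + K)%N * (s + alpha (m + K)%N).
    have sa : 0 <= s + alpha (m + K)%N by rewrite addr_ge0 // ltW.
    by rewrite ler_wpM2r // ler_wpM2l ?bS // ltW.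
  lra.
apply/cvgrPdist_lt => eps eps0.
(* Past this threshold, [b k >= eps] would make the product in [key] at least [e K + 1]. *)
have /cvgryPgt/(_ (series alpha K + (e K + 1) / (h / 2 * eps))) := alpha_sum.
move=> big; near=> k; rewrite sub0r normrN ger0_norm ?ip_ge0 //.
have Kk : (K <= k)%N by near: k; exact: nbhs_infty_ge.
have := key (k - K)%N; rewrite subnK // => keyk.
have Sk : series alpha K + (e K + 1) / (h / 2 * eps) < series alpha k by near: k.
rewrite ltNge; apply/negP => epsb; move: keyk; apply/negP; rewrite -ltNge.
have he : 0 < h / 2 * eps by rewrite mulr_gt0.
have : h / 2 * eps * ((e K + 1) / (h / 2 * eps)) <= h / 2 * b k * (series alpha k - series alpha K).
  apply: ler_pM; [exact: ltW| |by rewrite ler_wpM2l // ltW|lra].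
  by rewrite divr_ge0 ?addr_ge0 // ltW.
rewrite [X in X <= _]mulrC divfK ?lt0r_neq0 //; have := e0 k; lra.
Unshelve. all: by end_near. Qed.

Lemma cocoercive_mann_cvg (x0 : 'cV[R]_n) :
  exists xbar : 'cV[R]_n, xbar = A *m xbar /\ mann x0 k @[k --> \oo] --> xbar.
Proof.
have [X BX] := sqr_kernel_factor cocoercive_sqr_kernel.
pose p := (1%:M - B *m X) *m x0.
have Bp : B *m p = 0 by rewrite /p mulmxA (mul_kernel_proj BX) mul0mx.
exists p; split.
  by apply/eqP; rewrite -subr_eq0 -[X in X - _]mul1mx -mulmxBl Bp.
(* As [x0 = p + B (X x0)], the error is the residual of the iteration started at [X x0]. *)
have mannE k : mann x0 k = p + B *m mann (X *m x0) k.
  rewrite (@mann_mul _ _ _ _ B) // -{1}(mann_fix alpha k Bp) -mannD; congr (mann _ k).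
  by rewrite /p mulmxBl mul1mx mulmxA subrK.
apply: cvg_colP => i; have [c qc] := ip_coord_bound ipq i.
apply/cvgrPdist_lt => eps eps0.
(* [|c| + 1] is a positive upper bound of [c], hence a safe denominator. *)
have c0 : 0 < `|c| + 1 by rewrite ltr_wpDl.
have /cvgrPdist_lt/(_ (eps ^+ 2 / (`|c| + 1))) := mann_residual_cvg0 (X *m x0).
case; first by rewrite divr_gt0 // exprn_gt0.
move=> N _ HN; exists N => // k /HN /=.
rewrite sub0r normrN (ger0_norm (ip_ge0 ipq _)) => small.
have -> : mann x0 k i 0 = p i 0 + (B *m mann (X *m x0) k) i 0 by rewrite mannE [LHS]mxE.
rewrite opprD addNKr normrN -ltr_sqr ?nnegrE // ?ltW //.
rewrite real_normK ?num_real //; apply: le_lt_trans (qc _) _.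
set Q := q _ _ in small *; have Q0 : 0 <= Q by exact: ip_ge0.
move: small; rewrite ltr_pdivlMr // mulrC; apply: le_lt_trans.
by rewrite ler_wpM2r // (le_trans (ler_norm c)) // lerDl.
Qed.

End Sufficiency.

(** * Hermitian forms with diagonal weights over [R[i]] *)

Section WeightedProduct.
Context {R : rcfType}.
Implicit Types (z w : R[i]).

(* The real part of [z^* * w]. *)
Definition rdot z w : R := complex.Re z * complex.Re w + complex.Im z * complex.Im w.

Lemma rdotM z (u v : R[i]) : rdot (z * u) (z * v) = rdot z z * rdot u v.
Proof. by case: z u v => [a b] [c d] [e f]; rewrite /rdot /=; ring. Qed.

Lemma rdot_mulr z w : rdot w (z * w) = complex.Re z * rdot w w.
Proof. by case: z w => [a b] [c d]; rewrite /rdot /=; ring. Qed.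

Lemma rdotDr z w (u : R[i]) : rdot z (w + u) = rdot z w + rdot z u.
Proof. by case: z w u => [a b] [c d] [e f]; rewrite /rdot /=; ring. Qed.

Lemma rdotC z w : rdot z w = rdot w z.
Proof. by rewrite /rdot mulrC [X in _ + X]mulrC. Qed.

Lemma rdot_ge0 z : 0 <= rdot z z.
Proof. by rewrite addr_ge0 // -expr2 sqr_ge0. Qed.

Lemma rdot_eq0 z : rdot z z = 0 -> z = 0.
Proof.
case: z => a b; rewrite /rdot /= -!expr2 => /eqP.
by rewrite paddr_eq0 ?sqr_ge0 // !sqrf_eq0 => /andP[/eqP-> /eqP->].
Qed.

(** Vectors are functions, so that the induction below drops the first coordinate by composing with
    [lift ord0]. *)
Definition wdot n (d : 'I_n -> R) (u v : 'I_n -> R[i]) : R := \sum_i d i * rdot (u i) (v i).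

Section Fixed.
Context {n : nat} (d : 'I_n -> R).
Implicit Types u v x : 'I_n -> R[i].

Lemma wdotC u v : wdot d u v = wdot d v u.
Proof. by apply: eq_bigr => i _; rewrite rdotC. Qed.

Lemma wdotDr u v x : wdot d u (fun i => v i + x i) = wdot d u v + wdot d u x.
Proof. by rewrite -big_split /=; apply: eq_bigr => i _; rewrite rdotDr mulrDr. Qed.

Lemma wdot_mul z u : wdot d (fun i => u i * z) (fun i => u i * z) = wdot d u u * rdot z z.
Proof.
rewrite mulr_suml; apply: eq_bigr => i _.
by rewrite /= (mulrC (u i)) rdotM mulrCA mulrC.
Qed.

Hypothesis d0 : forall i, 0 < d i.

Lemma wdot_ge0 u : 0 <= wdot d u u.
Proof. by apply: sumr_ge0 => i _; rewrite mulr_ge0 ?rdot_ge0 // ltW. Qed.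

Lemma wdot_eq0 u : wdot d u u = 0 -> forall i, u i = 0.
Proof.
move=> /eqP; rewrite psumr_eq0 => [/allP uu i|i _]; last first.
  by rewrite mulr_ge0 ?rdot_ge0 // ltW.
have /implyP/(_ isT) := uu i (mem_index_enum i).
by rewrite mulf_eq0 gt_eqF //= => /eqP/rdot_eq0.
Qed.

(** The right side is the weighted squared norm of [a u + v]. It yields Young's inequality below,
    for [a = g] and [a = -1]. *)
Lemma wdot_comb_ge0 a u v : 0 <= a ^+ 2 * wdot d u u + 2 * a * wdot d u v + wdot d v v.
Proof.
rewrite !mulr_sumr -!big_split /=; apply: sumr_ge0 => i _.
have -> : a ^+ 2 * (d i * rdot (u i) (u i)) + 2 * a * (d i * rdot (u i) (v i)) +
    d i * rdot (v i) (v i) = d i * ((a * complex.Re (u i) + complex.Re (v i)) ^+ 2 +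
    (a * complex.Im (u i) + complex.Im (v i)) ^+ 2) by rewrite /rdot; ring.
by rewrite mulr_ge0 ?addr_ge0 ?sqr_ge0 // ltW.
Qed.

End Fixed.

(** Induction on the size: the first coordinate enters the others only through the column [c], and a
    large weight [K] on it dominates this coupling. *)
Lemma triangular_coercive n (L : 'I_n -> 'I_n -> R[i]) :
  (forall i j : 'I_n, (i < j)%N -> L i j = 0) -> (forall i, 0 < complex.Re (L i i)) ->
  exists (d : 'I_n -> R) (g M : R), [/\ forall i, 0 < d i, 0 < g, 0 <= M &
    forall x, let y i := \sum_j L i j * x j in
    g * wdot d x x <= wdot d x y /\ wdot d y y <= M * wdot d x x].
Proof.
elim: n L => [|n IH] L Ltrig Ldiag.
  by exists (fun=> 1), 1, 0; split=> // x /=; rewrite /wdot !big_ord0 !mulr0.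
have [||d [g [M [d0 g0 M0 dgM]]]] := IH (fun i j => L (lift ord0 i) (lift ord0 j)).
- by move=> i j ij; apply: Ltrig.
- by move=> i; apply: Ldiag.
pose l := L ord0 ord0; pose mu := complex.Re l; have mu0 : 0 < mu by exact: Ldiag.
pose c i := L (lift ord0 i) ord0; pose N := wdot d c c.
have N0 : 0 <= N by exact: wdot_ge0.
(* Half of [K * mu * s], with [s] the squared modulus of [x ord0], must cover the cost
   [N / (2 * g) * s] of the coupling; the summand [1] gives [N * s <= N * (K * s)] in the upper
   bound. *)
pose K := 1 + N / (g * mu); have K1 : 1 <= K.
  by rewrite lerDl divr_ge0 // ltW // mulr_gt0.
pose D i := if unlift ord0 i is Some j then d j else K.
have DE u v : wdot D u v =
    K * rdot (u ord0) (v ord0) + wdot d (fun i => u (lift ord0 i)) (fun i => v (lift ord0 i)).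
  rewrite /wdot big_ord_recl /D unlift_none; congr (_ + _).
  by apply: eq_bigr => i _; rewrite liftK.
exists D, (Num.min (mu / 2) (g / 2)), (rdot l l + 2 * N + 2 * M); split.
- by move=> i; rewrite /D; case: unliftP => [j _|_]; [exact: d0|lra].
- by rewrite lt_min !divr_gt0.
- by have l0 := rdot_ge0 l; lra.
move=> x y; rewrite !DE.
have y0 : y ord0 = l * x ord0.
  by rewrite /y big_ord_recl big1 ?addr0 // => j _; rewrite Ltrig ?mul0r.
set x' := fun i => x (lift ord0 i); set y' := fun i => y (lift ord0 i).
pose z i := \sum_j L (lift ord0 i) (lift ord0 j) * x' j; pose cx i := c i * x ord0.
have y'E : y' = (fun i => cx i + z i).
  by apply: funext => i; rewrite /y' /y big_ord_recl.
have [coer bnd] := dgM x'; rewrite -/z in coer bnd.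
have cxN : wdot d cx cx = N * rdot (x ord0) (x ord0) by exact: wdot_mul.
have xx0 := wdot_ge0 d0 x'; have s0 := rdot_ge0 (x ord0).
set s := rdot _ _ in cxN s0 *; set X := wdot d x' x' in coer bnd xx0 *.
have ml : Num.min (mu / 2) (g / 2) <= mu / 2 by rewrite ge_min lexx.
have gl : Num.min (mu / 2) (g / 2) <= g / 2 by rewrite ge_min lexx orbT.
have Ks0 : 0 <= K * s by rewrite mulr_ge0 //; lra.
split.
- rewrite y0 rdot_mulr -/s -/mu y'E wdotDr.
  have cross := wdot_comb_ge0 d0 g x' cx; rewrite -/X cxN in cross.
  have {}cross : 0 <= g / 2 * X + wdot d x' cx + N / (2 * g) * s.
    rewrite -(pmulr_rge0 _ (_ : 0 < 2 * g)) ?mulr_gt0 //.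
    suff -> : 2 * g * (g / 2 * X + wdot d x' cx + N / (2 * g) * s) =
      g ^+ 2 * X + 2 * g * wdot d x' cx + N * s by [].
    by field; rewrite gt_eqF.
  have KmuE : K * (mu * s) = mu / 2 * (K * s) + mu / 2 * s + N / (2 * g) * s.
    by rewrite /K; field; rewrite !gt_eqF.
  have : Num.min (mu / 2) (g / 2) * (K * s) <= mu / 2 * (K * s) by rewrite ler_wpM2r.
  have : Num.min (mu / 2) (g / 2) * X <= g / 2 * X by rewrite ler_wpM2r.
  have : 0 <= mu / 2 * s by rewrite mulr_ge0 // divr_ge0 // ltW.
  rewrite KmuE mulrDr; lra.
- rewrite y0 rdotM -/s y'E.
  (* The squared norm of [cx + z] is at most twice the sum of the squared norms, whence [2 * N] and
     [2 * M]. *)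
  have cross := wdot_comb_ge0 d0 (-1) cx z; rewrite cxN in cross.
  rewrite wdotDr !(wdotC d (fun i => cx i + z i)) !wdotDr (wdotC d z cx) cxN.
  have l0 := rdot_ge0 l.
  have : 0 <= (K - 1) * (N * s) by rewrite !mulr_ge0 // subr_ge0.
  have : 0 <= M * (K * s) by rewrite mulr_ge0.
  have : 0 <= N * X by rewrite mulr_ge0.
  have : 0 <= rdot l l * X by rewrite mulr_ge0.
  lra.
Qed.

End WeightedProduct.

(** * Triangularization over [R[i]] and a form adapted to the spectrum *)

Section Trigonalization.
Context {R : realType}.
Local Notation toC := (map_mx (real_complex R)).

Let ReM (z w : R[i]) :
  complex.Re (z * w) = complex.Re z * complex.Re w - complex.Im z * complex.Im w.
Proof. by case: z w => [? ?] []. Qed.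

Let ImM (z w : R[i]) :
  complex.Im (z * w) = complex.Re z * complex.Im w + complex.Im z * complex.Re w.
Proof. by case: z w => [? ?] []. Qed.

(** [L - L i i] is triangular with a zero on its diagonal, hence singular; the transpose is there
    because [det0P] gives a row vector. *)
Lemma trig_diag_eigenvector (F : fieldType) n (L : 'M[F]_n) i :
  is_trig_mx L -> exists2 w : 'cV[F]_n, w != 0 & L *m w = L i i *: w.
Proof.
move=> Ltrig; have : \det (L - (L i i)%:M)^T == 0.
  rewrite det_tr det_trig; last first.
    apply/is_trig_mxP => j k jk; rewrite !mxE (is_trig_mxP Ltrig) //.
    by rewrite -val_eqE ltn_eqF // subr0.
  by rewrite (bigD1 i) //= !mxE eqxx subrr mul0r.
case/det0P => v v0 vL; exists v^T; first by rewrite trmx_eq0.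
apply/eqP; rewrite -subr_eq0 -mul_scalar_mx -mulmxBl.
by rewrite -(trmxK (L - _)) -trmx_mul vL trmx0.
Qed.

(* [a + i b] runs over the complex eigenvectors of [B], with eigenvalue [r + i s]. *)
Definition spectrum_right n (B : 'M[R]_n) : Prop :=
  forall (a b : 'cV[R]_n) r s, B *m a = r *: a - s *: b -> B *m b = s *: a + r *: b ->
    (a != 0) || (b != 0) -> 0 < r.

(** An eigenvector of the Schur form [L] for [L i i], carried back by [invmx P], is one of [B]; its
    real and imaginary parts are the [a] and [b] of [spectrum_right]. *)
Lemma spectrum_right_trigonalization n (B : 'M[R]_n) :
  spectrum_right B ->
  exists (P L : 'M[R[i]]_n), [/\ P \in unitmx, P *m toC B = L *m P, is_trig_mx L &
    forall i, 0 < complex.Re (L i i)].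
Proof.
case: n B => [|n] B stable.
  by exists 1%:M, 0; split; rewrite ?unitmx1 ?mx0_is_trig ?mul1mx ?mulmx1 //;
    [exact: flatmx0|case].
have [P /unitarymx_unit Punit] := Schur (toC B) (ltn0Sn n).
rewrite /similar_to => Ltrig; rewrite conjumx // in Ltrig.
set L := P *m toC B *m invmx P in Ltrig; exists P, L; split=> // [|i].
  by rewrite /L mulmxKV.
have [w w0 Lw] := trig_diag_eigenvector i Ltrig.
set l := L i i in Lw *.
have [v v0 Bv] : exists2 v : 'cV_n.+1, v != 0 & toC B *m v = l *: v.
  have BvL : toC B *m (invmx P *m w) = invmx P *m (L *m w).
    by rewrite /L -!mulmxA mulKmx.
  exists (invmx P *m w); last by rewrite BvL Lw scalemxAr.
  by apply: contraNneq w0 => /(congr1 (mulmx P)); rewrite mulKVmx // mulmx0 => ->.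
have BvE k : (\sum_j (B k j)%:C * v j 0)%C = l * v k 0.
  move/matrixP/(_ k 0): Bv; rewrite !mxE => <-.
  by apply: eq_bigr => j _; rewrite !mxE.
apply: (stable (map_mx (@complex.Re R) v) (map_mx (@complex.Im R) v) _ (complex.Im l)).
(* [Rcomplex R] is [R[i]] seen as a real vector space, on which [Re] is additive. *)
- apply/colP => k; rewrite !mxE -ReM -BvE (raddf_sum (@complex.Re R : Rcomplex R -> R)).
  by apply: eq_bigr => j _; rewrite !mxE [RHS]ReM /= mul0r subr0.
- apply/colP => k; rewrite !mxE addrC -ImM -BvE.
  rewrite (raddf_sum (@complex.Im R : Rcomplex R -> R)).
  by apply: eq_bigr => j _; rewrite !mxE [RHS]ImM /= mul0r addr0.
- apply: contraR v0; rewrite negb_or !negbK => /andP[/eqP/colP re0 /eqP/colP im0].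
  apply/eqP/colP => k; move: (re0 k) (im0 k); rewrite !mxE.
  by case: (v k 0) => a b /= -> ->.
Qed.

End Trigonalization.

Lemma spectrum_right_cocoercive (R : realType) (n : nat) (B : 'M[R]_n) :
  spectrum_right B ->
  exists h q, [/\ 0 < h, inner_product q & cocoercive h q B].
Proof.
move=> /spectrum_right_trigonalization[P [L [Punit PB Ltrig Ldiag]]].
have [d [g [M [d0 g0 M0 dgM]]]] := triangular_coercive
  (fun i j ij => is_trig_mxP Ltrig i j ij) Ldiag.
pose S (x : 'cV[R]_n) i : R[i] := (P *m map_mx (real_complex R) x) i 0.
have SB x : S (B *m x) = (fun i => \sum_j L i j * S x j).
  by apply: funext => i; rewrite /S map_mxM mulmxA PB -mulmxA mxE.
(* Coercivity [g] and the bound [M] on the squared norm give cocoercivity; [M + 1] because [M] may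
   be [0]. *)
exists (2 * g / (M + 1)), (fun x y => wdot d (S x) (S y)); split.
- by rewrite divr_gt0 ?mulr_gt0 // ltr_wpDl.
- split=> [x y|a x y z|x x0]; first exact: wdotC.
    rewrite /wdot mulr_sumr -big_split /=; apply: eq_bigr => i _.
    have -> : S (a *: x + y) i = a%:C%C * S x i + S y i.
      by rewrite /S map_mxD map_mxZ mulmxDr -scalemxAr mxE [X in X + _]mxE.
    by case: (S x i) (S y i) (S z i) => [? ?] [? ?] [? ?]; rewrite /rdot /=; ring.
  rewrite lt_def wdot_ge0 // andbT; apply: contraNneq x0 => /(wdot_eq0 d0) Sx0.
  have /(congr1 (mulmx (invmx P))) : P *m map_mx (real_complex R) x = 0.
    by apply/colP => i; rewrite [LHS]Sx0 mxE.
  rewrite mulKmx // mulmx0 => /colP x0; apply/eqP/colP => i.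
  by have := x0 i; rewrite !mxE => -[].
- move=> z; rewrite SB; have [coer bnd] := dgM (S z).
  have S0 := wdot_ge0 d0 (S z).
  apply: (@le_trans _ _ (2 * g * wdot d (S z) (S z))); last by lra.
  rewrite mulrAC ler_pdivrMr ?ltr_wpDl // -!mulrA ler_pM2l // ler_pM2l //.
  by apply: le_trans bnd _; rewrite mulrC ler_wpM2l //; lra.
Qed.

(** * From convergence to cocoercivity *)

Section Necessity.
Context {R : realType} {n : nat} (A : 'M[R]_n) (alpha : R^nat).
Hypothesis alpha_gt0 : forall k, 0 < alpha k.
Hypothesis alpha_sum : series alpha k @[k --> \oo] --> +oo.
Local Notation B := (1%:M - A).
Local Notation mann := (mann_iteration alpha (mulmx A)).
Hypothesis mann_cvg : forall x0 : 'cV[R]_n, exists xbar : 'cV[R]_n,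
  xbar = A *m xbar /\ mann x0 k @[k --> \oo] --> xbar.

Lemma cvg_coord (x : ('cV[R]_n)^nat) (l : 'cV[R]_n) i :
  x k @[k --> \oo] --> l -> x k i 0 @[k --> \oo] --> l i 0.
Proof. exact: continuous_cvg (@coord_continuous R n 1 i 0 l). Qed.

(** If [w = B z] had a nonzero coordinate, the convergence of [z - series alpha k *: w] there would
    make [series alpha] converge. *)
Lemma convergent_sqr_kernel (z : 'cV[R]_n) : B *m (B *m z) = 0 -> B *m z = 0.
Proof.
move=> BBz; apply/colP => i; rewrite [RHS]mxE; set w := B *m z in BBz *.
have mannE k : mann z k = z - series alpha k *: w by exact: mann_nilpotent.
clearbody w; apply/eqP; apply: contraT => w0.
have [l [_ zl]] := mann_cvg z; have {}zl := cvg_coord (i := i) zl.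
have sE k : series alpha k = (z i 0 - mann z k i 0) / w i 0.
  by rewrite mannE !mxE opprB addrC subrK mulfK.
have : series alpha k @[k --> \oo] --> (z i 0 - l i 0) / w i 0.
  under eq_fun do rewrite sE.
  by apply: cvgMr_tmp; apply: cvgB => //; exact: cvg_cst.
set t := _ / _ => /cvgrPdist_lt/(_ _ ltr01) near_t.
have /cvgryPgt/(_ (t + 1)) far := alpha_sum.
have [k [kt tk]] := filter_ex (filterI near_t far).
move: kt; rewrite distrC => /(le_lt_trans (ler_norm _)) /=; move: tk => /=; lra.
Qed.

Section Spectrum.
Context {X : 'M[R]_n}.
Hypothesis BX : B = B *m B *m X.
Local Notation proj := (1%:M - B *m X).

Let projB : proj *m B = 0.
Proof. exact: kernel_proj_mul BX convergent_sqr_kernel. Qed.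

Let Bproj : B *m proj = 0. Proof. exact: mul_kernel_proj BX. Qed.

(** The limit lies in [ker B], so [proj] fixes it; but [proj] commutes with [B] and thus kills every
    iterate. *)
Lemma mann_cvg0 (x : 'cV[R]_n) : proj *m x = 0 -> mann x k @[k --> \oo] --> (0 : 'cV[R]_n).
Proof.
move=> px; have [l [Al xl]] := mann_cvg x.
suff l0 : l = 0 by rewrite -l0.
have Bl : B *m l = 0 by rewrite mulmxBl mul1mx -Al subrr.
rewrite -(kernel_proj_id BX convergent_sqr_kernel Bl).
have := cvg_mulmx (M := proj) xl.
under eq_fun do rewrite (mann_mul _ _ _ (etrans projB (esym Bproj))) px.
under eq_fun do rewrite mann_fix ?mulmx0 //.
by move=> c0; apply: (cvg_unique _ c0 (cvg_cst _)).
Qed.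

(* The iterates of the eigenvector [a + i b] are its multiples by the complex
   products of the [1 - alpha j * (r + i s)]; their moduli do not decrease if
   [r <= 0], whereas the iterates tend to [0]. *)
Lemma convergent_spectrum_right : spectrum_right (B + proj).
Proof.
move=> a b r s Ba Bb ab; rewrite ltNge; apply/negP => r0.
(* Applying [proj] to the eigenvector equations gives an eigenvalue [1] on [proj a + i proj b]; as
   [r + i s] differs from [1], both parts vanish and [a + i b] is an eigenvector of [B]. *)
have projD x : proj *m ((B + proj) *m x) = proj *m x.
  by rewrite mulmxA mulmxDr projB add0r mulmxBr mulmx1 mulmxA projB mul0mx subr0.
have pa : proj *m a = r *: (proj *m a) - s *: (proj *m b).
  by rewrite -{1}projD Ba mulmxBr -!scalemxAr.
have pb : proj *m b = s *: (proj *m a) + r *: (proj *m b).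
  by rewrite -{1}projD Bb mulmxDr -!scalemxAr.
(* [|1 - (r + i s)|^2], the determinant of the real system for [proj a] and [proj b]. *)
have rs0 : (1 - r) ^+ 2 + s ^+ 2 != 0.
  by rewrite gt_eqF // ltr_wpDr ?sqr_ge0 // exprn_gt0 //; lra.
have pab0 i : (proj *m a) i 0 = 0 /\ (proj *m b) i 0 = 0.
  have /colP/(_ i) := pa; have /colP/(_ i) := pb.
  move: (proj *m a) (proj *m b) => u v; rewrite !mxE => vE uE.
  have {}uE : (1 - r) * u i 0 + s * v i 0 = 0 by lra.
  have {}vE : (1 - r) * v i 0 - s * u i 0 = 0 by lra.
  split; apply: (mulfI rs0); rewrite mulr0.
  - transitivity ((1 - r) * ((1 - r) * u i 0 + s * v i 0) - s * ((1 - r) * v i 0 - s * u i 0)).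
      by ring.
    by rewrite uE vE !mulr0 subr0.
  - transitivity ((1 - r) * ((1 - r) * v i 0 - s * u i 0) + s * ((1 - r) * u i 0 + s * v i 0)).
      by ring.
    by rewrite uE vE !mulr0 addr0.
have pa0 : proj *m a = 0 by apply/colP => i; rewrite (pab0 i).1 mxE.
have pb0 : proj *m b = 0 by apply/colP => i; rewrite (pab0 i).2 mxE.
rewrite mulmxDl pa0 addr0 in Ba; rewrite mulmxDl pb0 addr0 in Bb.
have orbit k : exists u v, [/\ mann a k = u *: a - v *: b, mann b k = v *: a + u *: b &
    1 <= u ^+ 2 + v ^+ 2].
  elim: k => [|k [u [v [aE bE uv]]]].
    by exists 1, 0; rewrite !scale1r !scale0r subr0 add0r expr0n expr1n addr0.
  have ak := alpha_gt0 k; set al := alpha k in ak.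
  exists (u - al * (u * r - v * s)), (v - al * (u * s + v * r)); split.
  - rewrite mannS aE mulmxBr -!scalemxAr Ba Bb.
    by apply/colP => i; rewrite !mxE -/al; ring.
  - rewrite mannS bE mulmxDr -!scalemxAr Ba Bb.
    by apply/colP => i; rewrite !mxE -/al; ring.
  - have -> : (u - al * (u * r - v * s)) ^+ 2 + (v - al * (u * s + v * r)) ^+ 2 =
      (u ^+ 2 + v ^+ 2) * ((1 - al * r) ^+ 2 + (al * s) ^+ 2) by ring.
    apply: le_trans uv _; rewrite ler_peMr ?addr_ge0 ?sqr_ge0 //.
    have : al * r <= 0 by rewrite pmulr_rle0.
    by have := sqr_ge0 (al * s); have := sqr_ge0 (al * r); lra.
have [i abi] : exists i, 0 < a i 0 ^+ 2 + b i 0 ^+ 2.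
  have : exists i, (a i 0 != 0) || (b i 0 != 0).
    apply/not_existsP => ab0; move: ab; apply/negP; rewrite negb_or !negbK.
    by apply/andP; split; apply/eqP/colP => i; rewrite mxE; apply/eqP;
      have /negP := ab0 i; rewrite negb_or !negbK => /andP[].
  case=> i abi; exists i; rewrite lt_def paddr_eq0 ?sqr_ge0 // !sqrf_eq0.
  by rewrite negb_and abi addr_ge0 ?sqr_ge0.
have : mann a k i 0 ^+ 2 + mann b k i 0 ^+ 2 @[k --> \oo] --> (0 : R).
  have a0 := cvg_coord (i := i) (mann_cvg0 pa0); have b0 := cvg_coord (i := i) (mann_cvg0 pb0).
  under eq_fun do rewrite !expr2.
  have := cvgD (cvgM a0 a0) (cvgM b0 b0); rewrite mxE mulr0 addr0; exact.
move=> /cvgrPdist_lt/(_ _ abi) /filter_ex[k]; rewrite sub0r normrN.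
move=> /(le_lt_trans (ler_norm _)); apply/negP; rewrite -leNgt.
have [u [v [-> -> uv]]] := orbit k; rewrite !mxE.
have -> : (u * a i 0 - v * b i 0) ^+ 2 + (v * a i 0 + u * b i 0) ^+ 2 =
  (u ^+ 2 + v ^+ 2) * (a i 0 ^+ 2 + b i 0 ^+ 2) by ring.
by rewrite ler_peMl // ltW.
Qed.

End Spectrum.

(* On the range of [B], the matrix [B] coincides with [B + proj], so the form of
   [B + proj] pulled back along [B] is suitable; the term in [proj] makes it definite. *)
Lemma convergent_cocoercive : exists h q, [/\ 0 < h < 1, inner_product q & cocoercive h q B].
Proof.
have [X BX] := sqr_kernel_factor convergent_sqr_kernel.
have [h [q [h0 ipq coc]]] := spectrum_right_cocoercive (convergent_spectrum_right BX).
set proj := 1%:M - B *m X in coc.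
have projB : proj *m B = 0 by exact: kernel_proj_mul BX convergent_sqr_kernel.
pose dotp (x y : 'cV[R]_n) := \sum_i (proj *m x) i 0 * (proj *m y) i 0.
have dotp_ge0 x : 0 <= dotp x x by apply: sumr_ge0 => i _; rewrite -expr2 sqr_ge0.
(* Lowering [h] preserves cocoercivity; [1 / 2] ensures [h < 1]. *)
exists (Num.min h (1 / 2)), (fun x y => dotp x y + q (B *m x) (B *m y)); split.
- rewrite lt_min h0 gt_min; apply/andP; split; first lra.
  by apply/orP; right; lra.
- split=> [x y|a x y z|x x0].
  + by rewrite (ipC ipq); congr (_ + _); apply: eq_bigr => i _; rewrite mulrC.
  + rewrite mulmxDr -scalemxAr (ipP ipq) mulrDr addrACA; congr (_ + _).
    rewrite mulr_sumr -big_split /=; apply: eq_bigr => i _.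
    by rewrite mulmxDr -scalemxAr !mxE; ring.
  + have q0 := ip_ge0 ipq (B *m x); have p0 := dotp_ge0 x.
    rewrite lt_def addr_ge0 // andbT paddr_eq0 //; apply: contraNN x0 => /andP[/eqP px qx].
    have Bx : B *m x = 0.
      by apply/eqP; apply: contraLR qx => /(ip_gt0 ipq); rewrite lt_def => /andP[].
    rewrite -(kernel_proj_id BX convergent_sqr_kernel Bx) -/proj.
    apply/eqP/colP => i; rewrite [RHS]mxE; apply/eqP; rewrite -sqrf_eq0 expr2.
    move/eqP: px; rewrite psumr_eq0 => [|j _]; last by rewrite -expr2 sqr_ge0.
    by move/allP/(_ i (mem_index_enum i)).
(* The [dotp] term vanishes against the range of [B], leaving the cocoercivity of [B + proj] at
   [B z]. *)
- move=> z; have dotp0 x : dotp x (B *m z) = 0.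
    rewrite /dotp big1 // => i _.
    by rewrite [proj *m (B *m z)]mulmxA projB mul0mx [X in _ * X]mxE mulr0.
  rewrite !dotp0 !add0r; have := coc (B *m z).
  have -> : (B + proj) *m (B *m z) = B *m (B *m z).
    by rewrite mulmxDl [proj *m _]mulmxA projB mul0mx addr0.
  by apply: le_trans; rewrite ler_wpM2r ?ip_ge0 // ge_min lexx.
Qed.

End Necessity.

Theorem theorem2 (R : realType) (n : nat) (A : 'M[R]_n) (alpha : R^nat)
    (alpha_max : R)
    (alpha_bnd : forall k : nat, 0 < alpha k <= alpha_max)
    (alpha_cvg0 : alpha k @[k --> \oo] --> (0 : R))
    (alpha_sum : series alpha k @[k --> \oo] --> +oo) :
  strictly_pseudocontractive (fun x : 'cV[R]_n => A *m x) <->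
  (forall x0 : 'cV[R]_n, exists xbar : 'cV[R]_n,
     xbar = A *m xbar /\
     mann_iteration alpha (fun x : 'cV[R]_n => A *m x) x0 k @[k --> \oo]
       --> xbar).
Proof.
have alpha_gt0 k : 0 < alpha k by have /andP[] := alpha_bnd k.
rewrite -[X in strictly_pseudocontractive X]/(mulmx A).
split=> [/strictly_pseudocontractive_mulmxP[h [q [/andP[h0 _] ipq coc]]] x0|mann_cvg].
  exact: (cocoercive_mann_cvg alpha_gt0 alpha_cvg0 alpha_sum h0 ipq coc).
apply/strictly_pseudocontractive_mulmxP.
exact: (convergent_cocoercive alpha_gt0 alpha_sum mann_cvg).
Qed.
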